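(* Let $N$ be a normal subgroup of a finite group $G$, let $\{n_1^G,\dots,n_k^G\}$ be the set of $G$-conjugacy classes of $N$, and let $\Delta=\{\chi_1=1_G,\chi_2,\dots,\chi_k\}$ be a representative system of the equivalence classes of the equivalence relation with respect to $N$ on $\mathrm{Irr}(G)$. For each $i$ let $\theta_i\in\mathrm{Irr}(N)$ be an irreducible constituent of $(\chi_i)_N$, let $t_i=|G:I_G(\theta_i)|$ and $e_i=[(\chi_i)_N,\theta_i]$. Let $\mathsf{X}=(\chi_i(n_j))_{1\le i,j\le k}$ be the corresponding $G$-character table of $N$, $\overline{\mathsf{X}}^t$ its conjugate transpose, $\mathsf{D}=\mathrm{diag}(|n_1^G|,\dots,|n_k^G|)$, and $\Lambda_{\mathsf{X}}=\mathrm{diag}(\lambda_1,\dots,\lambda_k)$ with $\lambda_i=|N|\,t_i\,e_i^2$. Then $$\Lambda_{\mathsf{X}}=\mathsf{X}\,\mathsf{D}\,\overline{\mathsf{X}}^t.$$ In particular, $\mathsf{X}$ is non-singular.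
   Context: Characters are over $\mathbb{C}$. The $G$-conjugacy classes of $N$ are the conjugacy classes $x^G$ of $G$ with $x\in N$. $\chi_N$ denotes the restriction of $\chi$ to $N$, and $[\cdot,\cdot]$ the usual inner product of class functions. $G$ acts on $\mathrm{Irr}(N)$ by $\theta^g(x)=\theta(gxg^{-1})$, and $I_G(\theta)=\{g\in G\mid\theta^g=\theta\}$ is the inertia subgroup. Two characters $\chi,\phi\in\mathrm{Irr}(G)$ are equivalent with respect to $N$ if $[\chi_N,\phi_N]\ne 0$; this is an equivalence relation. The number of its classes equals the number of $G$-orbits on $\mathrm{Irr}(N)$, which equals the number $k$ of $G$-conjugacy classes of $N$ (known, via Brauer), so $\mathsf{X}$ is a square matrix. *)

(* Defs.v *)
From mathcomp Require Import all_boot all_order all_algebra all_fingroup.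
From mathcomp Require Import all_solvable all_field all_character.

Set Implicit Arguments.
Unset Strict Implicit.
Unset Printing Implicit Defensive.

Import GroupScope GRing.Theory Num.Theory.
Local Open Scope ring_scope.

Definition Gclasses (gT : finGroupType) (G N : {group gT}) : {set {set gT}} :=
  [set x ^: G | x in N].

(* Irreducible characters are represented by their indices in Iirr. *)
Definition Nequiv (gT : finGroupType) (G N : {group gT}) : rel (Iirr G) :=
  fun i j => '['Res[N] 'chi_i, 'Res[N] 'chi_j] != 0.

Definition Nequiv_classes (gT : finGroupType) (G N : {group gT}) :
    {set {set Iirr G}} :=
  equivalence_partition (Nequiv N) [set: Iirr G].

(* Each class contains chi i for exactly one index i; since every character
   lies in its own class, this makes chi injective. *)
Definition Nequiv_reps (gT : finGroupType) (G N : {group gT}) (k : nat)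
    (chi : 'I_k -> Iirr G) : Prop :=
  forall B, B \in Nequiv_classes G N -> exists! i, chi i \in B.

Definition Gchar_table (gT : finGroupType) (G : {group gT}) (k : nat)
    (chi : 'I_k -> Iirr G) (n : 'I_k -> gT) : 'M[algC]_k :=
  \matrix_(i, j) 'chi_(chi i) (n j).

Definition conj_index (gT : finGroupType) (G N : {group gT}) (t : Iirr N) :
    nat :=
  #|G : 'I_G['chi_t]|.

Definition ramification (gT : finGroupType) (G N : {group gT})
    (i : Iirr G) (t : Iirr N) : algC :=
  '['Res[N] 'chi_i, 'chi_t].

Definition class_size_mx (gT : finGroupType) (G : {group gT}) (k : nat)
    (n : 'I_k -> gT) : 'M[algC]_k :=
  diag_mx (\row_j #|n j ^: G|%:R).

Definition Lambda_mx (gT : finGroupType) (G N : {group gT}) (k : nat)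
    (chi : 'I_k -> Iirr G) (theta : 'I_k -> Iirr N) : 'M[algC]_k :=
  diag_mx (\row_i (#|N|%:R * (conj_index G (theta i))%:R
                   * ramification (chi i) (theta i) ^+ 2)).

(* Main.v *)
Require Import Defs.
From mathcomp Require Import all_boot all_order all_algebra all_fingroup.
From mathcomp Require Import all_solvable all_field all_character.

Set Implicit Arguments.
Unset Strict Implicit.
Unset Printing Implicit Defensive.

Import GroupScope GRing.Theory Num.Theory.
Local Open Scope ring_scope.

(** Grouping the sum defining [chi_N, phi_N] by G-classes shows that the (i, j)
    entry of X D X^* is |N| [(chi_i)_N, (chi_j)_N].  Off the diagonal this is 0
    by inequivalence; on the diagonal Clifford's theorem writes (chi_i)_N as e_i
    times the sum of the t_i conjugates of theta_i, and each of these has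
    multiplicity e_i in (chi_i)_N. *)

(** These classes are the orbits of [G] acting by conjugation, and normality makes [N] stable under
    that action. *)
Lemma Gclasses_partition (gT : finGroupType) (G N : {group gT}) :
  N <| G -> partition (Gclasses G N) N.
Proof.
move=> nNG; rewrite /Gclasses.
have -> : [set x ^: G | x in N] = orbit 'J G @: N.
  by apply: eq_imset => x; rewrite orbitJ.
by apply: orbit_partition; rewrite astabsJ normal_norm.
Qed.

(** Turns a sum over [N] into one over the columns of the table; injectivity of the class map keeps
    any class from being counted twice. *)
Lemma sum_Gclass_reps (gT : finGroupType) (G N : {group gT}) (k : nat)
    (n : 'I_k -> gT) (V : nmodType) (f : gT -> V) :
    N <| G -> injective (fun j => n j ^: G) ->
    [set n j ^: G | j : 'I_k] = Gclasses G N ->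
    {in N & G, forall x y, f (x ^ y)%g = f x} ->
  \sum_(x in N) f x = \sum_j f (n j) *+ #|n j ^: G|.
Proof.
move=> nNG n_inj nE fJ.
rewrite (set_partition_big _ (Gclasses_partition nNG)) -nE /=.
rewrite big_imset /=; last by move=> i j _ _; apply: n_inj.
apply: eq_bigr => j _; rewrite -sumr_const; apply: eq_bigr => x.
have nN : n j \in N.
  have : n j ^: G \in Gclasses G N by rewrite -nE; apply/imsetP; exists j.
  rewrite -(cover_partition (Gclasses_partition nNG)) => jG.
  by apply/bigcupP; exists (n j ^: G) => //; apply: class_refl.
by case/imsetP=> y Gy ->; apply: fJ.
Qed.

Lemma Gchar_table_gram (gT : finGroupType) (G N : {group gT}) (k : nat)
    (n : 'I_k -> gT) (chi : 'I_k -> Iirr G) :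
    N <| G -> injective (fun j => n j ^: G) ->
    [set n j ^: G | j : 'I_k] = Gclasses G N ->
  Gchar_table chi n *m class_size_mx G n
      *m (map_mx Num.conj (Gchar_table chi n))^T
  = \matrix_(i, j)
      (#|N|%:R * '['Res[N] 'chi_(chi i), 'Res[N] 'chi_(chi j)]).
Proof.
move=> nNG n_inj nE; have sNG := normal_sub nNG.
apply/matrixP=> i j; rewrite mul_mx_diag !mxE.
(* The factor [#|N|] cancels the normalisation of the inner product. *)
rewrite cfdotE mulVKf ?neq0CG //.
pose f x := 'chi_(chi i) x * ('chi_(chi j) x)^*.
have -> : \sum_(x in N) 'Res[N] 'chi_(chi i) x * ('Res[N] 'chi_(chi j) x)^*
        = \sum_(x in N) f x.
  by apply: eq_bigr => x Nx; rewrite !cfResE.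
rewrite (sum_Gclass_reps nNG n_inj nE); last first.
  by move=> x y _ Gy; rewrite /f !cfunJ.
by apply: eq_bigr => l _; rewrite !mxE /f mulrAC mulr_natr.
Qed.

Lemma cfnorm_Res_irr (gT : finGroupType) (G N : {group gT}) (i : Iirr G)
    (t : Iirr N) :
    N <| G -> t \in irr_constt ('Res[N] 'chi_i) ->
  '['Res[N] 'chi_i] = (conj_index G t)%:R * ramification i t ^+ 2.
Proof.
(* Only the second argument is expanded: one factor e comes out conjugated, the other arises as the
   inner product with each conjugate of ['chi_t]. *)
move=> nNG tP; rewrite {2}(Clifford_Res_sum_cfclass nNG tP) cfdotZr cfdot_sumr.
rewrite big_seq (eq_bigr (fun=> ramification i t)) => [|_ /cfclassP[y Gy ->]].
  rewrite -big_seq big_const_seq count_predT iter_addr_0 size_cfclass.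
  rewrite -/(ramification i t).
  (* A multiplicity is a natural number, so conjugation fixes it. *)
  have /natrP[m ->] : ramification i t \in Num.nat.
    by rewrite Cnat_cfdot_char ?cfRes_char ?irr_char.
  by rewrite conjC_nat mulrnAr [RHS]mulr_natl.
by rewrite cfdot_Res_conjg.
Qed.

(** If the inner product were nonzero, [chi i] and [chi j] would both lie in the class of [chi i],
    which contains only one representative. *)
Lemma Nequiv_reps_orthogonal (gT : finGroupType) (G N : {group gT}) (k : nat)
    (chi : 'I_k -> Iirr G) (i j : 'I_k) :
    Nequiv_reps N chi -> i != j ->
  '['Res[N] 'chi_(chi i), 'Res[N] 'chi_(chi j)] = 0.
Proof.
move=> reps neq_ij; apply: contraNeq neq_ij => equiv_ij.
pose B := [set c | Nequiv N (chi i) c].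
have BP : B \in Nequiv_classes G N.
  by apply/imsetP; exists (chi i) => //; apply/setP=> c; rewrite !inE.
have iB : chi i \in B.
  (* Reflexivity: the restriction is nonzero because its value at 1 is the positive degree. *)
  rewrite inE /Nequiv cfnorm_eq0; apply: contraTneq (irr1_gt0 (chi i)) => res0.
  by rewrite -(cfRes1 N) res0 cfunE Order.POrderTheory.ltxx.
have jB : chi j \in B by rewrite inE.
by have [l [_ l_uniq]] := reps B BP; rewrite -(l_uniq i iB) -(l_uniq j jB).
Qed.

Theorem theorem4p8 (gT : finGroupType) (G N : {group gT}) (nNG : N <| G)
    (k : nat) (n : 'I_k -> gT)
    (n_inj : injective (fun j => n j ^: G))
    (n_classes : [set n j ^: G | j : 'I_k] = Gclasses G N)
    (chi : 'I_k -> Iirr G)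
    (chi_reps : Nequiv_reps N chi)
    (chi_first : forall i : 'I_k, i = 0%N :> nat -> 'chi_(chi i) = 1)
    (theta : 'I_k -> Iirr N)
    (theta_constt : forall i, theta i \in irr_constt ('Res[N] 'chi_(chi i))) :
  Lambda_mx chi theta =
    Gchar_table chi n *m class_size_mx G n
      *m (map_mx Num.conj (Gchar_table chi n))^T
  /\ Gchar_table chi n \in unitmx.
Proof.
have gram : Lambda_mx chi theta =
    Gchar_table chi n *m class_size_mx G n
      *m (map_mx Num.conj (Gchar_table chi n))^T.
  rewrite (Gchar_table_gram chi nNG n_inj n_classes).
  apply/matrixP=> i j; rewrite !mxE.
  have [<-|neq_ij] := eqVneq i j; last first.
    by rewrite (Nequiv_reps_orthogonal chi_reps neq_ij) mulr0.
  by rewrite (cfnorm_Res_irr nNG (theta_constt i)) [RHS]mulrA.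
split=> //; apply: contraT => singX.
have : \det (Lambda_mx chi theta) == 0.
  rewrite gram !det_mulmx; move: singX.
  by rewrite unitmxE unitfE negbK => /eqP->; rewrite !mul0r.
(* A zero determinant would force some diagonal entry to vanish, but its three factors are all
   nonzero, e because [theta i] is a constituent. *)
rewrite det_diag => /prodf_eq0[i _]; rewrite mxE; apply: contraTT => _.
have e_neq0 : ramification (chi i) (theta i) != 0.
  by have := theta_constt i; rewrite irr_consttE.
apply: (mulf_neq0 _ (expf_neq0 2 e_neq0)).
by apply: mulf_neq0; [apply: neq0CG | apply: neq0CiG].
Qed.
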